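(* Let $G$ be a ribbon graph, $e\in E(G)$, and $n$ a positive integer. Then $f_n(G)=f_n(G\backslash e)+f_n(G/e)$. In particular, $\kappa(G)=\kappa(G\backslash e)+\kappa(G/e)$.
   Context: A ribbon graph $G=(V,E)$ is a surface with boundary formed by a set $V$ of vertex discs and a set $E$ of edge discs (ribbons), such that vertices and edges meet in disjoint line segments, each lying on the boundary of exactly one vertex and exactly one edge, and each edge contains exactly two such segments. For $F\subseteq E$, $(V,F)$ is the spanning ribbon subgraph obtained by deleting the edges not in $F$. $f_n(G)$ is the number of $F\subseteq E$ such that $(V,F)$ has exactly $n$ boundary components; $\kappa(G)=f_1(G)$ (the number of spanning quasi-trees). Deletion: $G\backslash e=(V,E\setminus\{e\})$. Partial dual $G^{\delta(A)}$ for $A\subseteq E$: glue a disc along each boundary component of $(V,A)$ (these are the new vertices), remove the interiors of the old vertex discs, keep the edge ribbons. Contraction: $G/e=G^{\delta(\{e\})}\backslash e$. *)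

(* Defs.v *)
From mathcomp Require Import all_boot.

Set Implicit Arguments.
Unset Strict Implicit.
Unset Printing Implicit Defensive.

(* Points x and y lie on the same curve when arcs are the pairs {z, f z} and
   {z, g z}; for fixed-point-free involutions f and g on a finite type these
   curves are circles, along which f-arcs and g-arcs alternate. *)
Definition same_circle (T : finType) (f g : T -> T) : rel T :=
  connect [rel x y | (y == f x) || (y == g x)].

(* A finite ribbon graph, not necessarily orientable or connected, as a cell
   complex.  Its 0-cells, the corners, are the end points of the segments in
   which vertex discs meet edge discs.  For a corner c,
     seg c  is the other end of the segment at c,
     side c is the other end of the free arc of the edge-disc boundary at c,
     varc c is the other end of the free arc of the vertex-disc boundary at c.
   A disc is given by its boundary circle: made of segments and sides for an
   edge disc, which has two segments and hence four corners, and of segments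
   and arcs for a vertex disc.  A vertex disc that meets no edge has no corner;
   those are the vertices outside the image of vtx. *)
Record ribbon_graph := RibbonGraph {
  vertex : finType;
  edge : finType;
  corner : finType;
  seg : corner -> corner;
  side : corner -> corner;
  varc : corner -> corner;
  vtx : corner -> vertex;
  edg : corner -> edge;
  segK : involutive seg;
  seg_neq : forall c, seg c != c;
  sideK : involutive side;
  side_neq : forall c, side c != c;
  varcK : involutive varc;
  varc_neq : forall c, varc c != c;
  vtx_circle : forall c d, (vtx c == vtx d) = same_circle seg varc c d;
  edg_circle : forall c d, (edg c == edg d) = same_circle seg side c d;
  edg_corners : forall e, #|[set c | edg c == e]| = 4
}.

Arguments seg {r}.
Arguments side {r}.
Arguments varc {r}.
Arguments vtx {r}.
Arguments edg {r}.

Section SameCircle.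
Variables (T : finType) (f g : T -> T).

Lemma same_circle_f x : same_circle f g x (f x).
Proof. by apply: connect1; rewrite /= eqxx. Qed.

Lemma same_circle_g x : same_circle f g x (g x).
Proof. by apply: connect1; rewrite /= eqxx orbT. Qed.

Lemma same_circle_sym :
  involutive f -> involutive g -> symmetric (same_circle f g).
Proof.
move=> fK gK; apply: symmetric_from_pre => x y.
have st u v : (v == f u) || (v == g u) -> same_circle f g v u.
  case/orP=> /eqP->; first by have := same_circle_f (f u); rewrite fK.
  by have := same_circle_g (g u); rewrite gK.
case/connectP=> p; elim: p x => [|z p IHp] x /= => [_ ->|]; first exact: connect0.
case/andP=> /st xz pz ey; exact: connect_trans (IHp _ pz ey) xz.
Qed.

Lemma same_circle_ind (P : T -> Prop) x :
    P x -> (forall y, P y -> P (f y)) -> (forall y, P y -> P (g y)) ->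
  forall y, same_circle f g x y -> P y.
Proof.
move=> Px Pf Pg y /connectP[p]; elim: p x Px => [|z p IHp] x Px /= => [_ ->|] //.
by case/andP=> /orP[]/eqP-> pz ey; apply: IHp pz ey; [apply: Pf | apply: Pg].
Qed.

End SameCircle.

Section Spanning.
Variables (G : ribbon_graph) (F : {set edge G}).

Lemma edg_seg (c : corner G) : edg (seg c) = edg c.
Proof. by apply/esym/eqP; rewrite edg_circle same_circle_f. Qed.

Lemma edg_side (c : corner G) : edg (side c) = edg c.
Proof. by apply/esym/eqP; rewrite edg_circle same_circle_g. Qed.

Definition span_edge := {e : edge G | e \in F}.
Definition span_corner := {c : corner G | edg c \in F}.

(* Once the edges outside F are deleted, their segments become part of the free
   boundary of the vertex discs.  Starting at c, walk along the vertex boundary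
   through such segments up to the first corner of an edge in F. *)
Definition skip (c : corner G) : corner G :=
  if edg c \in F then c else varc (seg c).
Definition land (c : corner G) : corner G := iter #|corner G| skip c.

Local Notation p := (fun c : corner G => varc (seg c)).

Let p_inj : injective p.
Proof. by move=> x y /(can_inj (@varcK G))/(can_inj (@segK G)). Qed.

Definition stray c := forall d, fconnect p c d -> edg d \notin F.

Lemma skip_id c : edg c \in F -> skip c = c.
Proof. by rewrite /skip => ->. Qed.

Lemma land_id c : edg c \in F -> land c = c.
Proof.
by move=> Fc; rewrite /land; elim: #|_| => //= n ->; apply: skip_id.
Qed.

Lemma iter_skip n c : edg (iter n skip c) \notin F ->
  forall k, k <= n -> edg (iter k p c) \notin F.
Proof.
elim: n c => [|n IHn] c; first by move=> nF [].
rewrite iterSr => nF [_|k le_kn].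
  apply: contra nF => Fc /=; rewrite skip_id //.
  by elim: n {IHn} => //= n IHn; rewrite skip_id.
have := IHn _ nF k le_kn; rewrite iterSr.
rewrite /skip; case: ifP => // Fc; case/negP: nF; rewrite skip_id //.
by elim: n {IHn le_kn} => //= n IHn; rewrite skip_id.
Qed.

Lemma landVstray c : edg (land c) \in F \/ stray c.
Proof.
have [|nF] := boolP (edg (land c) \in F); first by left.
right=> d cd; rewrite -(iter_findex cd); apply: (iter_skip nF).
apply: leq_trans (ltnW (findex_max cd)) _.
exact: max_card.
Qed.

Lemma stray_p c : stray (varc (seg c)) <-> stray c.
Proof. by split=> sc d; have := sc d; rewrite -same_fconnect1. Qed.

Lemma stray_seg c : stray c -> stray (seg c).
Proof.
move=> sc d /iter_findex <-; move: (findex _ _ d) => m.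
elim: m c sc => [|n IHn] c sc.
  by rewrite /= edg_seg; apply: sc; apply: connect0.
rewrite iterSr segK -(segK (varc c)); apply: IHn.
by apply/stray_p; rewrite segK varcK.
Qed.

Lemma stray_arc c : stray c -> stray (varc c).
Proof. by move=> /stray_seg/stray_p; rewrite segK. Qed.

Lemma in_stray c : edg c \in F -> ~ stray c.
Proof. by move=> Fc /(_ c (connect0 _ _)); rewrite Fc. Qed.

Lemma land_in c : ~ stray c -> edg (land c) \in F.
Proof. by case: (landVstray c). Qed.

Lemma land_step c : ~ stray c -> edg c \notin F -> land (varc (seg c)) = land c.
Proof.
move=> sc nFc; have <-: skip c = varc (seg c) by rewrite /skip (negPf nFc).
by rewrite /land -iterSr iterS skip_id // land_in.
Qed.

Lemma land_iter c : exists k, land c = iter k p c.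
Proof.
rewrite /land; elim: #|corner G| => [|n [k IHn]]; first by exists 0.
by rewrite iterS IHn /skip; case: ifP => _; [exists k | exists k.+1].
Qed.

Lemma land_seg c : ~ stray c -> edg c \notin F ->
  land (varc (land c)) = land (seg c).
Proof.
have nsseg d : ~ stray d -> ~ stray (seg d).
  by move=> sd /stray_seg; rewrite segK.
move=> sc nFc; have [k] := land_iter c; move: (land_in sc) => + ek.
rewrite {1}ek; elim: k c sc nFc {ek} => [|k IHk] c sc nFc.
  by rewrite (negPf nFc).
rewrite iterSr -(land_step sc nFc) => Fk.
have [Fpc|nFpc] := boolP (edg (varc (seg c)) \in F).
  by rewrite (land_id Fpc) varcK.
have spc : ~ stray (varc (seg c)) by move/stray_p.
by rewrite IHk // -[LHS]land_step ?edg_seg ?segK ?varcK //; apply: nsseg.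
Qed.

Lemma p_neq k d : iter k p d <> varc d.
Proof.
elim/ltn_ind: k d => -[|[|k]] IHk d.
- by move=> /esym/eqP; rewrite (negPf (varc_neq d)).
- by move=> /(can_inj (@varcK G))/eqP; rewrite (negPf (seg_neq d)).
rewrite iterS iterSr => /(can_inj (@varcK G)) e.
apply: (IHk k _ (varc (seg d))); first by rewrite ltnS leqnSn.
by rewrite varcK -[in RHS]e segK.
Qed.

Lemma span_seg_subproof (c : span_corner) : edg (seg (val c)) \in F.
Proof. by rewrite edg_seg (valP c). Qed.

Lemma span_side_subproof (c : span_corner) : edg (side (val c)) \in F.
Proof. by rewrite edg_side (valP c). Qed.

Lemma span_arc_subproof (c : span_corner) : edg (land (varc (val c))) \in F.
Proof.
apply: land_in => /stray_arc; rewrite varcK.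
exact/in_stray/(valP c).
Qed.

Definition span_seg c : span_corner := Sub (seg (val c)) (span_seg_subproof c).
Definition span_side c : span_corner := Sub (side (val c)) (span_side_subproof c).
Definition span_arc c : span_corner := Sub (land (varc (val c))) (span_arc_subproof c).
Definition span_vtx (c : span_corner) : vertex G := vtx (val c).
Definition span_edg (c : span_corner) : span_edge := Sub (edg (val c)) (valP c).

Lemma span_segK : involutive span_seg.
Proof. by move=> c; apply: val_inj; rewrite /= segK. Qed.

Lemma span_seg_neq c : span_seg c != c.
Proof. by rewrite -val_eqE seg_neq. Qed.

Lemma span_sideK : involutive span_side.
Proof. by move=> c; apply: val_inj; rewrite /= sideK. Qed.

Lemma span_side_neq c : span_side c != c.
Proof. by rewrite -val_eqE side_neq. Qed.

Lemma span_arcK : involutive span_arc.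
Proof.
move=> c; apply: val_inj => /=; have Fc := valP c.
have sac : ~ stray (varc (val c)).
  by move/stray_arc; rewrite varcK; apply/in_stray.
have [Fac|nFac] := boolP (edg (varc (val c)) \in F).
  by rewrite (land_id Fac) varcK land_id.
rewrite land_seg // -land_step ?segK ?varcK ?land_id ?edg_seg //.
by move/stray_seg; rewrite segK.
Qed.

Lemma span_arc_neq c : span_arc c != c.
Proof.
rewrite -val_eqE /=; have [k ->] := land_iter (varc (val c)).
by apply/eqP; rewrite -[RHS]varcK; apply: p_neq.
Qed.

Lemma span_circle (h : corner G -> corner G) (h' : span_corner -> span_corner) :
    involutive h -> (forall c, edg (h c) = edg c) ->
    (forall c, edg c \notin F -> h c = seg c) ->
    (forall c, val (h' c) = h (val c)) ->
  forall c d, same_circle h' span_arc c d = same_circle h varc (val c) (val d).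
Proof.
move=> hK edgh hseg vh' c d.
have h'K : involutive h' by move=> x; apply: val_inj; rewrite !vh' hK.
have symh := same_circle_sym hK (@varcK G).
apply/idP/idP.
  move: d; apply: same_circle_ind => [|d cd|d cd]; first exact: connect0.
    by rewrite vh'; apply: connect_trans cd (same_circle_f _ _ _).
  apply: connect_trans cd _ => /=.
  apply: connect_trans (same_circle_g h varc _) _.
  rewrite /land; elim: #|corner G| => [|n IHn]; first exact: connect0.
  apply: connect_trans IHn _; rewrite iterS {2}/skip; case: ifP => [_|nF].
    exact: connect0.
  rewrite -hseg ?nF //; apply: connect_trans (same_circle_f _ _ _) _.
  exact: same_circle_g.
have hs x : stray x -> stray (h x).
  by move=> sx; rewrite hseg; [apply: stray_seg | apply: sx; apply: connect0].
have P y : same_circle h varc (val c) y ->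
    ~ stray y /\ forall z, val z = land y -> same_circle h' span_arc c z.
  move: y; apply: same_circle_ind.
  - split; first exact/in_stray/(valP c).
    move=> z; rewrite land_id ?(valP c) // => /val_inj->; exact: connect0.
  - move=> y [sy cy]; have shy : ~ stray (h y) by move/hs; rewrite hK.
    split=> // z; have [Fy|nFy] := boolP (edg y \in F).
      rewrite land_id ?edgh // => ez.
      have ->: z = h' (Sub y Fy) by apply: val_inj; rewrite vh'.
      apply: connect_trans (same_circle_f _ _ _); apply: cy.
      by rewrite land_id.
    rewrite hseg // -land_seg // => ez.
    have ->: z = span_arc (Sub (land y) (land_in sy)) by apply: val_inj.
    by apply: connect_trans (same_circle_g _ _ _); apply: cy.
  - move=> y [sy cy]; have say : ~ stray (varc y) by move/stray_arc; rewrite varcK.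
    split=> // z ez.
    have ->: z = span_arc (Sub (land y) (land_in sy)).
      apply: val_inj; rewrite /= ez; have [Fy|nFy] := boolP (edg y \in F).
        by rewrite (land_id Fy).
      rewrite land_seg // -[RHS]land_step ?segK ?edg_seg //.
      by move/stray_seg; rewrite segK.
    by apply: connect_trans (same_circle_g _ _ _); apply: cy.
by move=> /P[_]; apply; rewrite land_id // (valP d).
Qed.

Lemma span_vtx_circle c d :
  (span_vtx c == span_vtx d) = same_circle span_seg span_arc c d.
Proof.
rewrite vtx_circle (@span_circle seg) //; [exact: segK | exact: edg_seg].
Qed.

Lemma span_edg_circle c d :
  (span_edg c == span_edg d) = same_circle span_seg span_side c d.
Proof.
rewrite -val_eqE /= edg_circle; apply/idP/idP; last first.
  move: d; apply: same_circle_ind => [|d cd|d cd]; first exact: connect0.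
    exact: connect_trans cd (same_circle_f seg side (val d)).
  exact: connect_trans cd (same_circle_g seg side (val d)).
suff P y : same_circle seg side (val c) y ->
    exists2 z, val z = y & same_circle span_seg span_side c z.
  by move=> /P[z /val_inj<-].
move: y; apply: same_circle_ind; first by exists c; last exact: connect0.
  move=> y [z <- cz]; exists (span_seg z) => //.
  exact: connect_trans cz (same_circle_f _ _ _).
move=> y [z <- cz]; exists (span_side z) => //.
exact: connect_trans cz (same_circle_g _ _ _).
Qed.

Lemma span_edg_corners e : #|[set c | span_edg c == e]| = 4.
Proof.
rewrite -(edg_corners (val e)) -(card_imset _ val_inj); apply: eq_card => c.
rewrite inE; apply/imsetP/eqP => [[d]|ec].
  by rewrite inE => /eqP<- ->.
have Fc : edg c \in F by rewrite ec (valP e).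
by exists (Sub c Fc); rewrite // inE; apply/eqP/val_inj.
Qed.

(* The spanning ribbon subgraph (V, F). *)
Definition spanning : ribbon_graph :=
  RibbonGraph span_segK span_seg_neq span_sideK span_side_neq
    span_arcK span_arc_neq span_vtx_circle span_edg_circle span_edg_corners.

End Spanning.

Definition delete (G : ribbon_graph) (e : edge G) : ribbon_graph :=
  spanning (~: [set e]).

Section Boundary.
Variables (G : ribbon_graph) (A : {set edge G}).

(* The boundary of (V, A), drawn in G, consists of the arcs of G, the sides of
   the edges in A and the segments of the edges not in A. *)
Definition bseg (c : corner G) : corner G :=
  if edg c \in A then side c else seg c.

(* The remaining arcs of the edge discs: once the vertex discs are replaced by
   discs glued along the boundary of (V, A), these are the sides. *)
Definition bside (c : corner G) : corner G :=
  if edg c \in A then seg c else side c.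

Definition bcurve (c : corner G) : {set corner G} :=
  [set d | same_circle bseg varc c d].

Definition bcurves : {set {set corner G}} := [set bcurve c | c : corner G].

Lemma bcurve_in c : bcurve c \in bcurves.
Proof. exact: imset_f. Qed.

Definition isolated (v : vertex G) : bool := [forall c, vtx c != v].

(* The boundary components of (V, A): curves through corners of G, and the
   boundaries of the vertex discs of G that meet no edge of G. *)
Definition bcomp : finType :=
  ({S : {set corner G} | S \in bcurves} +
   {v : vertex G | isolated v})%type.

Definition bcomp_of (c : corner G) : bcomp :=
  inl (exist _ (bcurve c) (bcurve_in c)).

Lemma edg_bseg c : edg (bseg c) = edg c.
Proof. by rewrite /bseg; case: ifP; rewrite ?edg_seg ?edg_side. Qed.

Lemma edg_bside c : edg (bside c) = edg c.
Proof. by rewrite /bside; case: ifP; rewrite ?edg_seg ?edg_side. Qed.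

Lemma bsegK : involutive bseg.
Proof.
move=> c; rewrite {1}/bseg edg_bseg /bseg.
by case: (edg c \in A); rewrite ?segK ?sideK.
Qed.

Lemma bseg_neq c : bseg c != c.
Proof. by rewrite /bseg; case: ifP; rewrite ?seg_neq ?side_neq. Qed.

Lemma bsideK : involutive bside.
Proof.
move=> c; rewrite {1}/bside edg_bside /bside.
by case: (edg c \in A); rewrite ?segK ?sideK.
Qed.

Lemma bside_neq c : bside c != c.
Proof. by rewrite /bside; case: ifP; rewrite ?seg_neq ?side_neq. Qed.

Lemma bcomp_circle c d : (bcomp_of c == bcomp_of d) = same_circle bseg varc c d.
Proof.
have sym := same_circle_sym bsegK (@varcK G).
apply/eqP/idP => [[/setP/(_ d)]|cd].
  by rewrite !inE => ->; apply: connect0.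
congr inl; apply: val_inj; apply/setP=> x; rewrite !inE.
exact: same_connect sym _ _ cd x.
Qed.

Lemma bedg_circle c d : (edg c == edg d) = same_circle bseg bside c d.
Proof.
rewrite edg_circle; apply: eq_connect => x y /=.
by rewrite /bseg /bside; case: ifP => _ //; rewrite orbC.
Qed.

(* The partial dual of G with respect to A: a disc is glued along each boundary
   component of (V, A), so that bcomp is the new set of vertices, the old vertex
   discs are removed and the edge discs are kept. *)
Definition partial_dual : ribbon_graph :=
  RibbonGraph bsegK bseg_neq bsideK bside_neq
    (@varcK G) (@varc_neq G) bcomp_circle bedg_circle (@edg_corners G).

End Boundary.

Definition contract (G : ribbon_graph) (e : edge G) : ribbon_graph :=
  @delete (partial_dual [set e]) e.

(* For A = E the boundary curves alternate between arcs and sides. *)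
Definition boundary (G : ribbon_graph) : finType := bcomp [set: edge G].

(* f_n(G) *)
Definition spanning_count (n : nat) (G : ribbon_graph) : nat :=
  #|[set F : {set edge G} | #|boundary (spanning F)| == n]|.

Definition kappa (G : ribbon_graph) : nat := spanning_count 1 G.

(* Main.v *)
Require Import Defs.
From mathcomp Require Import all_boot.

Set Implicit Arguments.
Unset Strict Implicit.
Unset Printing Implicit Defensive.

(* Every spanning subgraph can be counted inside G itself: the boundary
   components of (V, F) are the curves of G alternating between vertex arcs and
   [bseg F], together with the isolated vertices.  This description is compatible
   with passing to a spanning subgraph, and partial duality with respect to A
   only replaces F by its symmetric difference with A.  Hence the subsets F
   avoiding e correspond to those of the deletion, and the subsets containing e
   to those of the contraction. *)

(** Both images are in bijection with the classes of the common kernel on [A]. This compares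
    families of curves and vertices of different types through the corners that represent them. *)
Lemma eq_kernel_card_imset (T U V : finType) (A : {pred T})
    (f : T -> U) (g : T -> V) :
    {in A &, forall x y, (f x == f y) = (g x == g y)} ->
  #|f @: A| = #|g @: A|.
Proof.
have half (U' V' : finType) (f' : T -> U') (g' : T -> V') :
    {in A &, forall x y, (f' x == f' y) = (g' x == g' y)} ->
    #|f' @: A| <= #|g' @: A|.
  (* [k] chooses a preimage in [A], so [omap f' \o k] maps the image of [g'] onto that of [f']; the
     option type covers points without a preimage, as [U'] has no default element. *)
  move=> fg; pose k v := [pick x in A | g' x == v].
  rewrite -(card_imset _ (@Some_inj _)).
  apply: leq_trans (leq_imset_card (fun v => omap f' (k v)) (g' @: A)).
  apply/subset_leq_card/subsetP => _ /imsetP[_ /imsetP[x Ax ->] ->].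
  apply/imsetP; exists (g' x); first exact: imset_f.
  rewrite /k; case: pickP => [y /andP[Ay gyx]|/(_ x)]; last by rewrite Ax eqxx.
  by congr Some; apply/eqP; rewrite fg // eq_sym.
by move=> fg; apply/eqP; rewrite eqn_leq !half // => x y Ax Ay; rewrite fg.
Qed.

(** A walk from [c] never leaves the [f]-circle of [c], so agreement along that circle suffices. *)
Lemma eq_same_circle (T : finType) (f f' g : T -> T) c :
    (forall d, same_circle f g c d -> f d = f' d) ->
  same_circle f g c =1 same_circle f' g c.
Proof.
move=> ff' d; apply/idP/idP; last first.
  move: d; apply: same_circle_ind => [|d cd|d cd]; first exact: connect0.
    by rewrite -ff' //; apply: connect_trans cd (same_circle_f _ _ _).
  exact: connect_trans cd (same_circle_g _ _ _).
(* The first conjunct is carried through the induction because [f] and [f'] are known to agree only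
   on that circle. *)
suff P x : same_circle f g c x -> same_circle f g c x /\ same_circle f' g c x.
  by case/P.
move: x; apply: same_circle_ind => [|x [cx cx']|x [cx cx']].
- by split; apply: connect0.
- split; first exact: connect_trans cx (same_circle_f _ _ _).
  by rewrite ff' //; apply: connect_trans cx' (same_circle_f _ _ _).
- by split; [apply: connect_trans cx _ | apply: connect_trans cx' _];
    apply: same_circle_g.
Qed.

Section CurveCount.
Variables (G : ribbon_graph) (A : {set edge G}).

Lemma eq_bcurve (c d : corner G) :
  (bcurve A c == bcurve A d) = same_circle (bseg A) varc c d.
Proof. by rewrite -bcomp_circle. Qed.

Lemma card_bcomp : #|bcomp A| = #|bcurves A| + #|[set v : vertex G | isolated v]|.
Proof. by rewrite card_sum !card_sig cardsE. Qed.

End CurveCount.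

(** * Boundary components of a spanning subgraph, counted in the ambient graph *)

Section SpanningBoundary.
Variables (G : ribbon_graph) (S : {set edge G}).

Definition span_lift (F : {set edge (spanning S)}) : {set edge G} :=
  [set sval x | x in F].

Lemma in_span_lift F (x : edge (spanning S)) : (sval x \in span_lift F) = (x \in F).
Proof. exact/mem_imset/val_inj. Qed.

Lemma span_lift_sub F : span_lift F \subset S.
Proof. by apply/subsetP=> _ /imsetP[x _ ->]; apply: (valP x). Qed.

Lemma span_lift_inj : injective span_lift.
Proof. exact/imset_inj/val_inj. Qed.

Lemma span_liftT : span_lift setT = S.
Proof.
apply/eqP; rewrite eqEsubset span_lift_sub; apply/subsetP=> x Sx.
by rewrite -[x]/(sval (exist _ x Sx : edge (spanning S))) in_span_lift inE.
Qed.

Lemma span_lift_surj (B : {set edge G}) : B \subset S -> exists F, B = span_lift F.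
Proof.
move=> /subsetP sBS; exists [set x | sval x \in B].
apply/setP=> x; apply/idP/imsetP => [Bx|[y + ->]]; last by rewrite inE.
by exists (exist _ x (sBS _ Bx)); rewrite ?inE.
Qed.

Variable F : {set edge (spanning S)}.

Local Notation B := (span_lift F).

Lemma bseg_span_lift (c : corner (spanning S)) : sval (bseg F c) = bseg B (sval c).
Proof. by rewrite /bseg -[edg (sval c)]/(sval (edg c)) in_span_lift; case: ifP. Qed.

Let bseg_seg d : edg d \notin S -> bseg B d = seg d.
Proof.
move=> nS; rewrite /bseg; case: ifP => // /(subsetP (span_lift_sub F)).
by rewrite (negPf nS).
Qed.

(** Since [B] lies in [S], the curve follows [seg] at every deleted edge, and these are the
    stretches that the arcs of [spanning S] shortcut. *)
Lemma same_circle_bseg_span (c d : corner (spanning S)) :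
  same_circle (bseg F) varc c d = same_circle (bseg B) varc (sval c) (sval d).
Proof.
apply: (@span_circle G S (bseg B) (bseg F)).
- exact: bsegK.
- exact: edg_bseg.
- exact: bseg_seg.
- exact: bseg_span_lift.
Qed.

(** These vertices are the isolated ones of [(V, S)], described in [G]; those already isolated in
    [G] are included. *)
Let bare (v : vertex G) := [forall c, (vtx c == v) ==> (edg c \notin S)].

Let bareP c : reflect (forall d, same_circle seg varc c d -> edg d \notin S)
                      (bare (vtx c)).
Proof.
apply: (iffP forallP) => h d.
  by rewrite -vtx_circle eq_sym; apply/implyP/h.
by apply/implyP; rewrite eq_sym vtx_circle; apply: h.
Qed.

Let bareE v : isolated (G := spanning S) v = bare v.
Proof.
apply/forallP/forallP => h.
  move=> c; apply/implyP=> cv; apply/negP=> Sc.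
  by have /negP := h (exist _ c Sc : corner (spanning S)); apply.
by move=> c; apply/negP=> cv; have := h (sval c); rewrite cv (valP c).
Qed.

Let bare_curve c d : bare (vtx c) ->
  same_circle (bseg B) varc c d = same_circle seg varc c d.
Proof.
by move=> /bareP bc; apply/esym/eq_same_circle => x /bc/bseg_seg.
Qed.

(** A curve that avoided [S] would follow [seg] throughout, hence run around the whole vertex disc
    and make it bare. *)
Let bareN_curve c : ~~ bare (vtx c) ->
  exists d : corner (spanning S), bcurve B c = bcurve B (sval d).
Proof.
move=> nb.
have [|no] := boolP [exists d, same_circle (bseg B) varc c d && (edg d \in S)].
  case/existsP=> d /andP[cd Sd]; exists (exist _ d Sd).
  by apply/eqP; rewrite eq_bcurve.
have nS d : same_circle (bseg B) varc c d -> edg d \notin S.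
  by move=> cd; apply: contra no => Sd; apply/existsP; exists d; rewrite cd.
case/negP: nb; apply/bareP => d cd; apply: (nS).
by rewrite (@eq_same_circle _ _ seg) // => x /nS/bseg_seg.
Qed.

Let bareN_span (c : corner (spanning S)) : ~~ bare (vtx (sval c)).
Proof.
by apply/negP => /forallP/(_ (sval c)); rewrite eqxx (valP c).
Qed.

(* The curves of G meeting S are those of (V, S); each remaining one runs around
   a vertex disc that becomes isolated in (V, S). *)
Lemma card_bcomp_spanning : #|bcomp F| = #|bcomp B|.
Proof.
pose D := [set c : corner G | bare (vtx c)].
have dec : bcurves B = [set bcurve B (sval c) | c : corner (spanning S)]
                       :|: [set bcurve B c | c in D].
  apply/setP=> X; rewrite inE; apply/imsetP/orP => [[c _ ->]|].
    have [b|/bareN_curve[d ->]] := boolP (bare (vtx c)); last by left; apply: imset_f.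
    by right; apply: imset_f; rewrite inE.
  by case=> /imsetP[c _ ->]; [exists (sval c) | exists c].
have disj : [disjoint [set bcurve B (sval c) | c : corner (spanning S)]
                    & [set bcurve B c | c in D]].
  rewrite disjoint_subset; apply/subsetP=> X /imsetP[c _ ->]; rewrite inE.
  apply/imsetP=> -[d]; rewrite inE => bd /eqP.
  rewrite eq_sym eq_bcurve bare_curve // -vtx_circle => /eqP e.
  by have := bareN_span c; rewrite -e bd.
have iso : [set v | isolated (G := spanning S) v]
           = [set v : vertex G | isolated v] :|: [set vtx c | c in D].
  apply/setP=> v; rewrite !inE bareE; apply/idP/orP.
    move=> bv; have [|nv] := boolP (isolated (G := G) v); first by left.
    right; move: nv; rewrite negb_forall => /existsP[c /negPn/eqP e].
    by apply/imsetP; exists c; rewrite ?inE e.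
  case=> [/forallP h|/imsetP[c]]; last by rewrite inE => ? ->.
  by apply/forallP=> c; rewrite (negPf (h c)).
have idisj : [disjoint [set v : vertex G | isolated v] & [set vtx c | c in D]].
  rewrite disjoint_subset; apply/subsetP=> v; rewrite !inE => /forallP h.
  by apply/imsetP=> -[c _ e]; have := h c; rewrite e eqxx.
rewrite !card_bcomp iso dec !cardsU !disjoint_setI0 // !cards0 !subn0.
(* At a bare vertex the curve is the vertex circle, so each curve lost in [(V, S)] is replaced by
   one newly isolated vertex. *)
have -> : #|[set bcurve B c | c in D]| = #|[set vtx c | c in D]|.
  apply: eq_kernel_card_imset => c d; rewrite inE => bc _.
  by rewrite eq_bcurve bare_curve // vtx_circle.
have -> : #|[set bcurve B (sval c) | c : corner (spanning S)]| = #|bcurves F|.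
  apply: (@eq_kernel_card_imset (corner (spanning S))) => c d _ _.
  by rewrite !eq_bcurve same_circle_bseg_span.
by rewrite -addnA (addnC #|[set vtx c | c in D]|).
Qed.

End SpanningBoundary.

Lemma card_boundary_spanning (G : ribbon_graph) (F : {set edge G}) :
  #|boundary (spanning F)| = #|bcomp F|.
Proof. by rewrite card_bcomp_spanning span_liftT. Qed.

(** * Boundary components of a partial dual *)

Definition symdiff (T : finType) (X Y : {set T}) : {set T} :=
  (X :\: Y) :|: (Y :\: X).

Section PartialDualBoundary.
Variables (G : ribbon_graph) (A : {set edge G}).

(** The dual exchanges segments and sides exactly on the edges of [A], so there membership in [X] is
    read the opposite way. *)
Lemma bseg_partial_dual (X : {set edge (partial_dual A)}) (c : corner G) :
  bseg (G := partial_dual A) X c = bseg (symdiff X A : {set edge G}) c.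
Proof.
rewrite /bseg !inE /=; rewrite -[edg (r := partial_dual A) c]/(edg (r := G) c).
rewrite /bside /bseg.
by case: (edg c \in A); case: (edg (r := G) c \in X).
Qed.

Lemma card_bcomp_partial_dual (X : {set edge (partial_dual A)}) :
  #|bcomp X| = #|bcomp (symdiff X A : {set edge G})|.
Proof.
rewrite !card_bcomp; congr (_ + _).
  apply: (@eq_kernel_card_imset (corner G)) => c d _ _; rewrite !eq_bcurve.
  by apply: eq_connect => x y /=; rewrite bseg_partial_dual.
have -> : #|[set v : vertex G | isolated v]| = #|{: {v : vertex G | isolated v}}|.
  by rewrite card_sig cardsE.
pose j (v : {v : vertex G | isolated v}) : vertex (partial_dual A) := inr v.
have j_inj : injective j by move=> v w [].
rewrite -cardsT -[RHS](card_imset _ j_inj).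
(* A vertex of the dual that comes from a curve has a corner on it, so only the [inr] vertices are
   isolated. *)
apply: eq_card => v; rewrite inE; apply/forallP/imsetP => [|[x _ ->] c //].
case: v => [[U UA]|x] h; last by exists x.
have /imsetP[c _ eU] := UA; case/eqP: (h c).
by congr inl; apply: val_inj; rewrite /= eU.
Qed.

End PartialDualBoundary.

(** * Subsets avoiding or containing the edge *)

Lemma spanning_countE n (H : ribbon_graph) :
  spanning_count n H = #|[set F : {set edge H} | #|bcomp F| == n]|.
Proof. by apply: eq_card => F; rewrite !inE card_boundary_spanning. Qed.

Lemma spanning_count_delete n (G : ribbon_graph) (e : edge G) :
  spanning_count n (delete e)
  = #|[set F : {set edge G} | (#|bcomp F| == n) && (e \notin F)]|.
Proof.
rewrite spanning_countE -(card_imset _ (@span_lift_inj _ (~: [set e]))).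
apply: eq_card => F; rewrite inE; apply/imsetP/andP => [[X]|[nF]].
  rewrite inE card_bcomp_spanning => ? ->; split=> //.
  by have := span_lift_sub X; rewrite subsetC sub1set inE.
rewrite -in_setC -sub1set subsetC => /span_lift_surj[X eF]; exists X => //.
by rewrite inE card_bcomp_spanning -eF.
Qed.

(** The deletion in [contract] leaves subsets of the dual that avoid [e]. On these, symmetric
    difference with [[set e]] just adds [e], a bijection onto the subsets of [G] containing [e]. *)
Lemma spanning_count_contract n (G : ribbon_graph) (e : edge G) :
  spanning_count n (contract e)
  = #|[set F : {set edge G} | (#|bcomp F| == n) && (e \in F)]|.
Proof.
have dE (F : {set edge G}) : e \notin F -> symdiff F [set e] = e |: F.
  move=> nF; apply/setP=> x; rewrite !inE.
  by case: eqVneq => [->|_]; rewrite ?(negPf nF) // andbF orbF.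
rewrite /contract spanning_count_delete.
rewrite -[LHS](card_in_imset (f := fun F : {set edge G} => e |: F)).
  apply: eq_card => F; rewrite inE; apply/imsetP/andP => [[X]|[nF eF]].
    rewrite inE => /andP[nX eX] ->; rewrite setU11 -dE //.
    by rewrite -card_bcomp_partial_dual.
  exists (F :\ e); last by rewrite setD1K.
  by rewrite inE card_bcomp_partial_dual dE ?setD1K ?setD11 ?nF.
move=> X Y; rewrite !inE => /andP[_ eX] /andP[_ eY] /(congr1 (fun Z => Z :\ e)).
by rewrite !setU1K.
Qed.

Lemma spanning_count_delete_contract n (G : ribbon_graph) (e : edge G) :
  spanning_count n G = spanning_count n (delete e) + spanning_count n (contract e).
Proof.
rewrite spanning_count_delete spanning_count_contract spanning_countE addnC.
rewrite -(cardsID [set F : {set edge G} | e \in F]).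
by congr (_ + _); apply: eq_card => F; rewrite !inE // andbC.
Qed.

Theorem theorem5p6 (G : ribbon_graph) (e : edge G) (n : nat) (n_gt0 : 0 < n) :
  spanning_count n G = spanning_count n (delete e) + spanning_count n (contract e)
  /\ kappa G = kappa (delete e) + kappa (contract e).
Proof. by split; apply: spanning_count_delete_contract. Qed.
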